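(* Let $(X,d)$ be a bounded and $1$-regular metric space. Then there exists a Borel map $f:X\to\mathbb R$ such that $$\frac{1}{\mu(X)^2}\int_X\int_X\frac{\big||f(x)-f(y)|-d(x,y)\big|}{\mathrm{diam}(X)}\,d\mu(x)\,d\mu(y)\le \frac{C}{\mu(X)^3}\int_X\int_X\int_X\frac{\partial(\{x,y,z\})}{\mathrm{diam}(X)}\,d\mu(x)\,d\mu(y)\,d\mu(z),$$ where $\mu=\mathcal H^1$ and $C$ is a constant depending only on the regularity constant of $X$.
   Context: $(X,d)$ is a $1$-regular metric space with regularity constant $C_X\ge1$ if $\mathrm{diam}(X)>0$ and $C_X^{-1}r\le\mathcal H^1(B_r(x))\le C_Xr$ for all $x\in X$ and $r\in(0,2\,\mathrm{diam}(X))$, where $B_r(x)$ is the open ball. The triangular excess of three points is $\partial(\{x_1,x_2,x_3\})=\min_{\sigma\in S_3}\{d(x_{\sigma(1)},x_{\sigma(2)})+d(x_{\sigma(2)},x_{\sigma(3)})-d(x_{\sigma(1)},x_{\sigma(3)})\}$. *)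

(* Defs.v *)
From HB Require Import structures.
From mathcomp Require Import all_boot all_order all_fingroup all_algebra.
From mathcomp Require Import all_classical all_reals all_analysis.
From mathcomp Require Import lra.

Set Implicit Arguments.
Unset Strict Implicit.
Unset Printing Implicit Defensive.

Import Order.TTheory GRing.Theory Num.Theory.

Local Open Scope classical_set_scope.
Local Open Scope ring_scope.

(* [measurableType] requires a distinguished point, so the metric spaces
   considered here are pointed; the point plays no other role. *)
#[short(type="pmetricType")]
HB.structure Definition PointedMetric (R : numDomainType) :=
  {T of Pointed T & Metric R T}.

Section metric_notions.
Context {R : realType} {X : metricType R}.

Definition bounded_space := exists M : R, forall x y : X, mdist x y <= M.

(* The element 0 matters only for A = set0, where it gives diam set0 = 0. *)
Definition diam (A : set X) : \bar R :=
  ereal_sup (0%E |` [set (mdist p.1 p.2)%:E | p in A `*` A]).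

(* The identity permutation, used as the unit of the iterated minimum, is one
   of the permutations ranged over, so that this is the minimum over 'S_3. *)
Definition excess (x y z : X) : R :=
  let p := tnth [tuple x; y; z] in
  let e (s : 'S_3) := mdist (p (s 0)) (p (s 1)) + mdist (p (s 1)) (p (s 2))
                      - mdist (p (s 0)) (p (s 2)) in
  \big[Order.min/e 1%g]_(s : 'S_3) e s.

Definition delta_cover (delta : R) (A : set X) : set ((set X)^nat) :=
  [set F | (forall i, diam (F i) <= delta%:E)%E /\ A `<=` \bigcup_i F i].

(* Finite covers are included, padded with set0.  In dimension 1 the usual
   normalising constant of the Hausdorff measure is 1. *)
Definition hausdorff1_delta (delta : R) (A : set X) : \bar R :=
  ereal_inf [set (\sum_(i <oo) diam (F i))%E | F in delta_cover delta A].

Definition hausdorff1 (A : set X) : \bar R :=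
  ereal_sup [set hausdorff1_delta delta A | delta in [set d : R | 0 < d]].

(* [ball x r] is the open ball, by [ballEmdist]. *)
Definition regular1 (C : R) :=
  [/\ 1 <= C, (0 < diam [set: X])%E &
   forall (x : X) (r : R), 0 < r -> (r%:E < 2%:E * diam [set: X])%E ->
     ((C^-1 * r)%:E <= hausdorff1 (ball x r) <= (C * r)%:E)%E].

End metric_notions.
Arguments bounded_space {R} X.
Arguments regular1 {R} X C.

Section hausdorff1_outer_measure.
Context {R : realType} {X : metricType R}.
Implicit Types (A B C S : set X) (d e : R).
Local Open Scope ereal_scope.

Lemma diam_ge0 A : 0 <= diam A.
Proof. by apply: ereal_sup_ubound; left. Qed.

Lemma diam0 : diam (set0 : set X) = 0.
Proof.
apply/eqP; rewrite eq_le diam_ge0 andbT; apply: ge_ereal_sup.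
by move=> _ [->//|[[? ?] [[]]]].
Qed.

Lemma le_mdist_diam A x y : A x -> A y -> (mdist x y)%:E <= diam A.
Proof. by move=> Ax Ay; apply: ereal_sup_ubound; right; exists (x, y). Qed.

Lemma hausdorff1_delta_ge0 d A : 0 <= hausdorff1_delta d A.
Proof.
apply: le_ereal_inf_tmp => _ [F _ <-].
by apply: nneseries_ge0 => i _ _; exact: diam_ge0.
Qed.

Lemma hausdorff1_delta0 d : (0 < d)%R -> hausdorff1_delta d (set0 : set X) = 0.
Proof.
move=> d0; apply/eqP; rewrite eq_le hausdorff1_delta_ge0 andbT.
apply: ereal_inf_lbound; exists (fun=> set0).
  by split => // i; rewrite diam0 lee_fin ltW.
by apply: eseries0 => i _ _; rewrite diam0.
Qed.

Lemma le_hausdorff1_delta d : {homo (@hausdorff1_delta R X d) : A B / A `<=` B >-> A <= B}.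
Proof.
move=> A B AB; apply/ereal_inf_le_tmp => _ [F [dF BF] <-].
by exists F => //; split => //; exact: subset_trans BF.
Qed.

Lemma hausdorff1_delta_anti d e A :
  (d <= e)%R -> hausdorff1_delta e A <= hausdorff1_delta d A.
Proof.
move=> de; apply/ereal_inf_le_tmp => _ [F [dF AF] <-].
by exists F => //; split => // i; rewrite (le_trans (dF i))// lee_fin.
Qed.

Lemma hausdorff1_delta_subadditive d :
  sigma_subadditive (hausdorff1_delta d : set X -> \bar R).
Proof.
set mu := hausdorff1_delta d => A.
have [[i ioo]|] := pselect (exists i, mu (A i) = +oo).
  rewrite (eseries_pinfty _ _ ioo) ?leey// => n _.
  by rewrite -ltNye (lt_le_trans _ (hausdorff1_delta_ge0 _ _)).
rewrite -forallNE => Aoo.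
suff add2e (e : {posnum R}) :
    mu (\bigcup_n A n) <= \sum_(i <oo) mu (A i) + e%:num%:E.
  by apply/lee_addgt0Pr => _/posnumP[].
rewrite (le_trans _ (epsilon_trick _ _ _))//; last first.
  by move=> n; exact: hausdorff1_delta_ge0.
pose P n (B : (set X)^nat) := delta_cover d (A n) B /\
  \sum_(k <oo) diam (B k) <= mu (A n) + (e%:num / (2 ^ n.+1)%:R)%:E.
have [G PG] : {G : ((set X)^nat)^nat & forall n, P n (G n)}.
  apply: (@choice _ _ P) => n.
  have en1 : (0 < e%:num / (2 ^ n.+1)%:R)%R by [].
  have fmu : mu (A n) \is a fin_num.
    by rewrite ge0_fin_numE ?hausdorff1_delta_ge0// ltey; apply/eqP.
  have [x [B AB <-] xS] := lb_ereal_inf_adherent en1 fmu.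
  by exists B; split => //; exact/ltW.
have diamG_ge0 x : 0 <= (diam \o uncurry G) x by exact: diam_ge0.
apply: (@le_trans _ _ (\esum_(i in setT) (diam \o uncurry G) i)).
  apply: ereal_inf_lbound => /=.
  have /card_esym/ppcard_eqP[f] := card_nat2.
  exists (uncurry G \o f).
    split => [i|]; first by rewrite /=; case: (f i) => a b; exact: (PG a).1.1.
    apply: (@subset_trans _  (\bigcup_n \bigcup_k G n k)) => [t [i _]|].
      by move=> /((PG i).1.2) -[j _ ?]; exists i => //; exists j.
    move=> t [i _ [j _ Bijt]]; exists (f^-1%FUN (i, j)) => //=.
    by rewrite invK ?inE.
  rewrite -(esum_pred_image (diam \o uncurry G) _ xpredT) ?[fun=> _]set_true//.
  by rewrite image_eq.
rewrite (_ : esum _ _ = \sum_(i <oo) \sum_(j <oo ) diam (G i j)); last first.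
  pose J : nat -> set (nat * nat) := fun i => [set (i, j) | j in setT].
  rewrite (_ : setT = \bigcup_k J k); last first.
    by rewrite predeqE => -[a b]; split => // _; exists a => //; exists b.
  rewrite esum_bigcupT /=; last 2 first.
    - apply/trivIsetP => i j _ _ ij.
      rewrite predeqE => -[n m] /=; split => //= -[] [_] _ [<-{n} _].
      by move=> [m' _] [] /esym/eqP; rewrite (negbTE ij).
    - by move=> *; exact: diam_ge0.
  rewrite -(image_id [set: nat]) -fun_true esum_pred_image//; last first.
    by move=> n _; apply: esum_ge0 => *; exact: diam_ge0.
  apply: eq_eseriesr => /= j _.
  rewrite -(esum_pred_image (diam \o uncurry G) (pair j) predT)//=.
  - by congr esum; rewrite predeqE => -[a b]; split; move=> [i _ <-]; exists i.
  - by move=> *; exact: diam_ge0.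
  - by move=> ? ? _ _; exact: (@can_inj _ _ _ snd).
apply: lee_lim.
- apply: is_cvg_nneseries => n *.
  by apply: nneseries_ge0 => m *; exact: diam_ge0.
- by apply: is_cvg_nneseries => n *; apply: adde_ge0 => //; exact: hausdorff1_delta_ge0.
- by near=> n; apply: lee_sum => i _; exact: (PG i).2.
Unshelve. all: by end_near. Qed.

Lemma hausdorff1_ge_delta d A :
  (0 < d)%R -> hausdorff1_delta d A <= hausdorff1 A.
Proof. by move=> d0; apply: ereal_sup_ubound; exists d. Qed.

Lemma hausdorff1_le A (M : \bar R) :
  (forall d, (0 < d)%R -> hausdorff1_delta d A <= M) -> hausdorff1 A <= M.
Proof. by move=> AM; apply: ge_ereal_sup => _ [d d0 <-]; exact: AM. Qed.

Lemma hausdorff1_ge0 A : 0 <= hausdorff1 A.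
Proof.
by apply: le_trans (hausdorff1_ge_delta A ltr01); exact: hausdorff1_delta_ge0.
Qed.

Lemma hausdorff10 : hausdorff1 (set0 : set X) = 0.
Proof.
apply/eqP; rewrite eq_le hausdorff1_ge0 andbT.
by apply: hausdorff1_le => d d0; rewrite hausdorff1_delta0.
Qed.

Lemma le_hausdorff1 : {homo (@hausdorff1 R X) : A B / A `<=` B >-> A <= B}.
Proof.
move=> A B AB; apply: hausdorff1_le => d d0.
exact: le_trans (le_hausdorff1_delta d AB) (hausdorff1_ge_delta B d0).
Qed.

Lemma hausdorff1_subadditive : sigma_subadditive (@hausdorff1 R X).
Proof.
move=> F; apply: hausdorff1_le => d d0.
apply: le_trans (hausdorff1_delta_subadditive d F) _.
apply: lee_nneseries => [i _ _|i _]; first exact: hausdorff1_delta_ge0.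
exact: hausdorff1_ge_delta.
Qed.

HB.instance Definition _ := isOuterMeasure.Build R X (@hausdorff1 R X)
  hausdorff10 hausdorff1_ge0 le_hausdorff1 hausdorff1_subadditive.

Lemma hausdorff1_delta_separated d e A B : (d < e)%R ->
  (forall x y, A x -> B y -> (e <= mdist x y)%R) ->
  hausdorff1_delta d A + hausdorff1_delta d B <= hausdorff1_delta d (A `|` B).
Proof.
move=> de AB; apply: le_ereal_inf_tmp => _ [F [dF ABF] <-].
pose G C i := if `[< F i `&` C !=set0 >] then F i else set0.
have d0 : 0 <= d%:E by exact: le_trans (diam_ge0 (F 0%N)) (dF 0%N).
have coverG C : C `<=` A `|` B -> delta_cover d C (G C).
  move=> CAB; split=> [i|x Cx].
    by rewrite /G; case: asboolP => _; rewrite ?diam0.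
  have [i _ Fix] := ABF _ (CAB _ Cx); exists i => //.
  by rewrite /G; case: asboolP => // -[]; exists x.
apply: (@le_trans _ _ (\sum_(i <oo) diam (G A i) + \sum_(i <oo) diam (G B i))).
  by apply: leeD; apply: ereal_inf_lbound;
    [exists (G A)|exists (G B)] => //; apply: coverG; [left|right].
rewrite -nneseriesD; try by move=> i _ _; exact: diam_ge0.
apply: lee_nneseries => [i _ _|i _]; first by rewrite adde_ge0 ?diam_ge0.
rewrite /G; case: asboolP => [[x [Fx Ax]]|_]; case: asboolP => [[y [Fy By]]|_];
  rewrite ?diam0 ?adde0 ?add0e ?diam_ge0//.
have := le_trans (le_mdist_diam Fx Fy) (dF i).
by rewrite lee_fin leNgt (lt_le_trans de (AB _ _ Ax By)).
Qed.

Lemma hausdorff1_separated e A B : (0 < e)%R ->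
  (forall x y, A x -> B y -> (e <= mdist x y)%R) ->
  hausdorff1 A + hausdorff1 B <= hausdorff1 (A `|` B).
Proof.
move=> e0 AB; set M := hausdorff1 (A `|` B).
have [->|Moo] := eqVneq M +oo; first by rewrite leey.
have Mfin : M \is a fin_num by rewrite ge0_fin_numE ?hausdorff1_ge0// ltey.
have subfin C : C `<=` A `|` B -> hausdorff1 C \is a fin_num.
  move=> CAB; rewrite ge0_fin_numE ?hausdorff1_ge0//.
  by rewrite (le_lt_trans (le_hausdorff1 CAB))// ltey.
have deltafin d C : (0 < d)%R -> C `<=` A `|` B ->
    hausdorff1_delta d C \is a fin_num.
  move=> d0 CAB; rewrite ge0_fin_numE ?hausdorff1_delta_ge0//.
  rewrite (le_lt_trans (hausdorff1_ge_delta _ d0))//.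
  by rewrite -ge0_fin_numE ?hausdorff1_ge0 ?subfin.
rewrite -leeBrDr ?subfin//; apply: hausdorff1_le => a a0.
rewrite leeBrDr ?subfin// addeC -leeBrDr ?deltafin//.
apply: hausdorff1_le => b b0; rewrite leeBrDr ?deltafin//.
pose d := Num.min (Num.min a b) (e / 2)%R.
have d0 : (0 < d)%R by rewrite !lt_min a0 b0 divr_gt0.
have da : (d <= a)%R by rewrite /d !ge_min lexx.
have db : (d <= b)%R by rewrite /d !ge_min lexx orbT.
have de : (d < e)%R.
  by rewrite (@le_lt_trans _ _ (e / 2)%R)// /d ?ge_min ?lexx ?orbT//; lra.
rewrite addeC; apply: le_trans (hausdorff1_ge_delta _ d0).
apply: le_trans (hausdorff1_delta_separated de AB).
by apply: leeD; exact: hausdorff1_delta_anti.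
Qed.

Lemma hausdorff1_caratheodory_closed C :
  closed C -> (@hausdorff1 R X).-caratheodory C.
Proof.
move=> clC; apply: le_caratheodory_measurable => S.
pose H := @hausdorff1 R X.
rewrite -[leLHS]/(H _ + H _) -[leRHS]/(H S).
have [->|Soo] := eqVneq (H S) +oo; first by rewrite leey.
pose A (n : nat) := [set x | S x /\ forall y, C y -> (n.+1%:R^-1 <= mdist x y)%R].
pose D n := A n.+2 `\` A n.+1.
have leinv (m n : nat) : (m <= n)%N -> (n.+1%:R^-1 <= m.+1%:R^-1 :> R)%R.
  by move=> mn; rewrite lef_pV2 ?posrE// ler_nat.
have leA m n : (m <= n)%N -> A m `<=` A n.
  by move=> mn x [Sx xC]; split => // y /xC; apply: le_trans; exact: leinv.
have stepA n : H (A n) + H (D n) <= H (A n.+2).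
  pose e : R := (n.+1%:R^-1 - n.+2%:R^-1)%R.
  have e0 : (0 < e)%R by rewrite subr_gt0 ltf_pV2 ?posrE// ltr_nat.
  apply: le_trans (hausdorff1_separated e0 _) _ => [x y [_ xC] [[Sy _] Ay]|].
    have [c Cc yc] : exists2 c, C c & (mdist y c < n.+2%:R^-1)%R.
      apply: contrapT => nc; apply: Ay; split => // c Cc.
      by rewrite leNgt; apply/negP => ?; apply: nc; exists c.
    rewrite /e lerBlDr; apply: le_trans (xC _ Cc) _.
    by apply: le_trans (metric_triangle x y c) _; rewrite lerD2l ltW.
  by apply: le_hausdorff1 => x [/(leA n n.+2)|[]]//; apply; rewrite ltnW.
have sumD n : \sum_(0 <= k < n) H (D k) <= H (A n) + H (A n.+1).
  elim: n => [|n ih]; first by rewrite big_geq// adde_ge0 ?hausdorff1_ge0.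
  rewrite big_nat_recr//=; apply: le_trans (leeD2r _ ih) _.
  by rewrite addeAC addeC leeD2l.
have AS n : A n `<=` S by move=> x [].
have Dsum : \sum_(0 <= k <oo) H (D k) < +oo.
  apply: (@le_lt_trans _ _ (H S + H S)).
    apply: lime_le; first by apply: is_cvg_nneseries => *; exact: hausdorff1_ge0.
    apply: nearW => n; apply: le_trans (sumD n) _.
    by apply: leeD; exact: le_hausdorff1.
  by rewrite lte_add_pinfty// ltey.
have tail n : H (S `&` ~` C) <= H (A n.+1) + \sum_(n <= k <oo) H (D k).
  have cover : S `&` ~` C `<=` A n.+1 `|` \bigcup_(k in ~` `I_n) D k.
    move=> x [Sx nCx].
    have [m Am] : exists m, A m x.
      have oC : nbhs x (~` C).
        by have := closed_openC clC; rewrite openE; exact.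
      have [e /= e0 xeC] := (nbhs_ballP _ _).1 oC.
      exists (Num.truncn e^-1); split => // y Cy.
      rewrite leNgt; apply/negP => xy; apply: (xeC y) => //.
      rewrite ballEmdist/=; apply: lt_le_trans xy _.
      rewrite invf_ple ?posrE//; apply/ltW; exact: truncnS_gt.
    have exA : exists m, `[< A m x >] by exists m; exact/asboolP.
    have [{Am}m /asboolP Am minm] := ex_minnP exA.
    have [mn|nm] := leqP m n.+1; first by left; exact: leA Am.
    right; case: m Am minm nm => [//|[//|k]] Am minm nk; exists k.
      by move=> /=; rewrite ltnNge; apply/negP; rewrite negbK.
    by split => // /asboolP /minm; rewrite ltnn.
  apply: le_trans (le_hausdorff1 cover) _.
  apply: le_trans (outer_measureU2 H _ _) _.
  by rewrite leeD2l//; exact: outer_measure_sigma_subadditive_tail.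
have tail0 := nneseries_tail_cvg Dsum (fun k _ => hausdorff1_ge0 (D k)).
have sepC n : H (S `&` C) + H (A n) <= H S.
  have n0 : (0 < n.+1%:R^-1 :> R)%R by [].
  rewrite addeC; apply: le_trans (hausdorff1_separated n0 _) _.
    by move=> x y [_ xC] [_ Cy]; exact: xC.
  by apply: le_hausdorff1 => x [/AS|[]].
apply/lee_addgt0Pr => e e0.
have nbe : nbhs 0 [set u : \bar R | u < e%:E] by exact: open_ereal_lt'.
have [n _ /(_ n (leqnn n))/ltW tn] : \forall n \near \oo,
  \sum_(n <= k <oo) H (D k) < e%:E by exact: tail0 nbe.
apply: (@le_trans _ _ (H (S `&` C) + (H (A n.+1) + \sum_(n <= k <oo) H (D k)))).
  by rewrite leeD2l.
by rewrite addeA leeD.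
Qed.

End hausdorff1_outer_measure.

Definition borel {R : realType} (X : pmetricType R) :=
  g_sigma_algebraType (@open X).

HB.instance Definition _ (R : realType) (X : pmetricType R) :=
  Measurable.on (borel X).

Section hausdorff1_measure.
Context {R : realType} (X : pmetricType R).
Local Open Scope ereal_scope.

Lemma hausdorff1_caratheodory (A : set (borel X)) :
  measurable A -> (@hausdorff1 R X).-caratheodory A.
Proof.
apply: smallest_sub => [|U oU].
  exact: (@sigma_algebra_measurable _ (caratheodory_type (@hausdorff1 R X))).
rewrite -(setCK U); apply: (@caratheodory_measurable_setC _ _ (@hausdorff1 R X)).
exact/hausdorff1_caratheodory_closed/open_closedC.
Qed.

Definition hausdorff1_measure : set (borel X) -> \bar R := @hausdorff1 R X.

Let hausdorff1_measure0 : hausdorff1_measure set0 = 0.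
Proof. exact: hausdorff10. Qed.

Let hausdorff1_measure_ge0 A : 0 <= hausdorff1_measure A.
Proof. exact: hausdorff1_ge0. Qed.

Let hausdorff1_measure_sigma_additive :
  semi_sigma_additive hausdorff1_measure.
Proof.
move=> F mF tF mUF; have cF n := hausdorff1_caratheodory (mF n).
apply: (@caratheodory_measure_sigma_additive R X (@hausdorff1 R X)) => //.
exact: (hausdorff1_caratheodory mUF).
Qed.

HB.instance Definition _ := isMeasure.Build _ _ _ hausdorff1_measure
  hausdorff1_measure0 hausdorff1_measure_ge0 hausdorff1_measure_sigma_additive.

End hausdorff1_measure.
Arguments hausdorff1_measure {R} X.

(* Main.v *)
Require Import Defs.
From mathcomp Require Import all_boot all_order all_fingroup all_algebra.
From mathcomp Require Import all_classical all_reals all_analysis.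
From mathcomp Require Import measurable_realfun ring lra.

(* Fix two base points p, q at distance comparable to the diameter and let f be
   the coordinate along the "line" through p and q, read off from the distances
   to p and q.  If all the triples among p, q, x, y have small excess, then
   either f almost preserves the distance of x and y, or p, q, x, y almost form
   a quasicycle: a 4-cycle whose opposite sides are equal and whose diagonals
   are sums of two sides.  As in Menger's theorem, a fifth point z away from the
   other four rules out the quasicycles.  So the defect of f at (x, y) is bounded
   by the sum of the excesses of the ten triples among p, q, x, y, z, for every z
   outside four small balls.  By regularity such z fill at least half of X, and
   one integrates over z, x and y; p and then q are chosen by averaging so that
   the integrals in which they are frozen are controlled by the full triple
   integral.

   The partial integrals of the excess are Lipschitz functions of the remaining
   variables, hence Borel, and the excess is symmetric, so that neither product
   measurability nor Fubini's theorem is needed. *)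

Set Implicit Arguments.
Unset Strict Implicit.
Unset Printing Implicit Defensive.

Import Order.TTheory GRing.Theory Num.Theory.
Import numFieldNormedType.Exports.

Local Open Scope classical_set_scope.
Local Open Scope ring_scope.

(** * Nearly collinear points *)

Section collinearity.
Context {R : realType} {X : metricType R}.
Implicit Types (a b c d p q x y z : X) (e : R).

Definition between e a b c := mdist a b + mdist b c <= mdist a c + e.

(** The three cases put [a], [b], [c] in the middle, in this order. The error [e] is additive, so
    that an excess can serve as [e]. *)
Definition collinear e a b c :=
  [\/ between e b a c, between e a b c | between e a c b].

Lemma between_sym e a b c : between e a b c -> between e c b a.
Proof.
by rewrite /between (metric_sym c b) (metric_sym b a) (metric_sym c a) addrC.
Qed.

Lemma collinear_rot e a b c : collinear e a b c -> collinear e b c a.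
Proof.
by case=> /between_sym h; [apply: Or33|apply: Or31|apply: Or32] => //;
  exact: between_sym.
Qed.

Lemma collinear_swap e a b c : collinear e a b c -> collinear e b a c.
Proof.
by case=> h; [apply: Or32|apply: Or31|apply: Or33] => //; exact: between_sym.
Qed.

(* The conditions force opposite sides to be almost equal, and both diagonals
   to be almost the sum of two consecutive sides. *)
Definition quasicycle e a b c d :=
  [/\ between e a b c, between e b c d, between e c d a & between e d a b].

Lemma quasicycle_rot e a b c d : quasicycle e a b c d -> quasicycle e b c d a.
Proof. by case. Qed.

(** Up to O(e), passing from c through a to z forces zb = za + ab and zd = za + ad, while bd = ab +
    ad and ad = bc. Then none of b, d, z can be the middle one unless za, ab or bc is short. *)
Lemma quasicycle_not_beyond e a b c d z : 0 <= e -> quasicycle e a b c d ->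
  collinear e b d z ->
  3 * e < mdist a b -> 3 * e < mdist b c -> 3 * e < mdist z a ->
  ~ between e c a z.
Proof.
move=> e0 [abc bcd cda dab] bdz ab bc za caz.
have sym := (metric_sym b a, metric_sym c a, metric_sym d a, metric_sym c b,
  metric_sym d b, metric_sym d c, metric_sym z a, metric_sym z d).
move: (metric_triangle c b z) (metric_triangle d a z) (metric_triangle c d z)
  (metric_triangle b a z) (metric_triangle b a d).
move: bdz; rewrite /collinear.
move: abc bcd cda dab ab bc za caz; rewrite /between !sym.
move: (mdist a b) (mdist a c) (mdist a d) (mdist b c) (mdist b d) (mdist c d)
  (mdist a z) (mdist b z) (mdist c z) (mdist d z) => ab ac ad bc bd cd az bz cz dz.
by move=> ? ? ? ? ? ? ? ? [] *; lra.
Qed.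

(** With z on the side ab, up to O(e) one has zc = zb + bc, zd = za + ad and cd = za + zb. A middle
    point c, d or z of the triple c, d, z then makes zb, za or bc short, respectively. *)
Lemma quasicycle_not_side e a b c d z : 0 <= e -> quasicycle e a b c d ->
  collinear e c d z ->
  3 * e < mdist b c -> 3 * e < mdist z a -> 3 * e < mdist z b ->
  ~ between e a z b.
Proof.
move=> e0 [abc bcd cda dab] cdz bc za zb azb.
have sym := (metric_sym b a, metric_sym c a, metric_sym d a, metric_sym c b,
  metric_sym d b, metric_sym d c, metric_sym z a, metric_sym z b,
  metric_sym z c, metric_sym z d).
move: (metric_triangle a z c) (metric_triangle b c d) (metric_triangle d a z)
  (metric_triangle a d c) (metric_triangle c b z) (metric_triangle b z d).
move: cdz; rewrite /collinear.
move: abc bcd cda dab bc za zb azb; rewrite /between !sym.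
move: (mdist a b) (mdist a c) (mdist a d) (mdist b c) (mdist b d) (mdist c d)
  (mdist a z) (mdist b z) (mdist c z) (mdist d z) => ab ac ad bc bd cd az bz cz dz.
by move=> ? ? ? ? ? ? ? ? [] *; lra.
Qed.

(* [z] cannot be past a vertex along a diagonal, so it is between the ends of
   both diagonals, hence between two consecutive vertices. *)
Lemma quasicycle_degenerate e a b c d z : 0 <= e -> quasicycle e a b c d ->
  collinear e a b z -> collinear e b c z -> collinear e c d z ->
  collinear e d a z -> collinear e a c z -> collinear e b d z ->
  3 * e < mdist z a -> 3 * e < mdist z b -> 3 * e < mdist z c ->
  3 * e < mdist z d ->
  3 * e < mdist a b -> 3 * e < mdist c d ->
  mdist b c <= 3 * e \/ mdist a d <= 3 * e.
Proof.
move=> e0 C abz bcz cdz daz acz bdz za zb zc zd ab cd.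
have [?|bc] := leP (mdist b c) (3 * e); first by left.
have [?|ad] := leP (mdist a d) (3 * e); first by right.
exfalso.
have dbz : collinear e d b z by exact: collinear_swap.
have caz : collinear e c a z by exact: collinear_swap.
have azc : between e a z c.
  case: (acz) => [h|h|//]; exfalso.
    by apply: (quasicycle_not_beyond e0 C bdz ab bc za).
  have := quasicycle_not_beyond e0 (quasicycle_rot (quasicycle_rot C)) dbz cd.
  by rewrite metric_sym; apply.
have bzd : between e b z d.
  case: (bdz) => [h|h|//]; exfalso.
    by have := quasicycle_not_beyond e0 (quasicycle_rot C) caz bc cd zb; apply.
  have := quasicycle_not_beyond e0
    (quasicycle_rot (quasicycle_rot (quasicycle_rot C))).
  by move=> /(_ _ acz); rewrite (metric_sym d a); apply.
have nazb := quasicycle_not_side e0 C cdz bc za zb.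
have nbzc := quasicycle_not_side e0 (quasicycle_rot C) daz cd zb zc.
have ndza := quasicycle_not_side e0
  (quasicycle_rot (quasicycle_rot (quasicycle_rot C))) bcz ab zd za.
have sym := (metric_sym b a, metric_sym c a, metric_sym d a, metric_sym c b,
  metric_sym d b, metric_sym d c, metric_sym z a, metric_sym z b,
  metric_sym z c, metric_sym z d).
(* The middle point of a, b, z is a or b. In the first case the side da and bd <= ba + ad bring z
   close to d or a; in the second the side bc and ac <= ab + bc bring z close to b or c. *)
case: abz => // abz.
  case: daz => // daz.
    move: (metric_triangle b a d) zd; move: abz daz bzd; rewrite /between !sym.
    move=> *; lra.
  move: (metric_triangle b a d) za; move: abz daz bzd; rewrite /between !sym.
  move=> *; lra.
case: bcz => // bcz.
  move: (metric_triangle a b c) zb; move: abz bcz azc; rewrite /between !sym.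
  move=> *; lra.
move: (metric_triangle a b c) zc; move: abz bcz azc; rewrite /between !sym.
move=> *; lra.
Qed.

(* On a line with p at 0 and q at [mdist p q], this is the coordinate of x. *)
Definition line_coord p q x :=
  if mdist q x <= mdist p x then mdist p x else mdist p q - mdist q x.

(** * Four points: on a line or in a quasicycle *)

Lemma norm_dist_le (u d k : R) : u <= d + k -> - u <= d + k ->
  d <= u + k \/ d <= - u + k -> `| `|u| - d | <= k.
Proof. by case: (ger0P u) => u0 h1 h2 [h|h]; rewrite ler_norml; lra. Qed.

(** Each triple has a middle point. The one pattern in which the coordinates need not give the
    distance of x and y has x and y between p and q, and p and q between x and y: a quasicycle. *)
Lemma same_side_quasicycle e p q x y : 0 <= e ->
  collinear e p q x -> collinear e p q y -> collinear e p x y ->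
  collinear e q x y -> 10 * e < mdist p q ->
  mdist q x <= mdist p x -> mdist q y <= mdist p y ->
  quasicycle e p x q y \/
  (mdist x y <= mdist p x - mdist p y + 10 * e \/
   mdist x y <= - (mdist p x - mdist p y) + 10 * e).
Proof.
move=> e0 pqx pqy pxy qxy pq qpx qpy.
have sym := (metric_sym q p, metric_sym x p, metric_sym y p, metric_sym x q,
  metric_sym y q, metric_sym y x).
move: (metric_triangle x q y) (metric_triangle p x q) (metric_triangle p y q).
move: pq qpx qpy pqx pqy pxy qxy; rewrite /quasicycle /collinear /between !sym.
move: (mdist p q) (mdist p x) (mdist p y) (mdist q x) (mdist q y) (mdist x y).
move=> pq px py qx qy xy h qpx qpy.
case=> [?|?|?]; first by move=> *; exfalso; lra.
  case=> [?|?|?]; first by move=> *; exfalso; lra.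
    by case=> ? *; right; [exfalso; lra|right; lra|left; lra].
  by move=> *; right; left; lra.
case=> [?|?|?]; first by move=> *; exfalso; lra.
  by move=> *; right; right; lra.
case=> [?|?|?]; [|by move=> *; right; right; lra|by move=> *; right; left; lra].
case=> ? *; [left|right; right; lra|right; left; lra].
by split; lra.
Qed.

(** Here [u] is the difference of the line coordinates of x and y. Two patterns of middle points now
    escape the line, one for each of the cycles p, x, q, y and p, q, x, y. *)
Lemma opposite_sides_quasicycle e p q x y : 0 <= e ->
  collinear e p q x -> collinear e p q y -> collinear e p x y ->
  collinear e q x y -> 10 * e < mdist p q ->
  mdist q x <= mdist p x -> mdist p y <= mdist q y ->
  let u := mdist p x - (mdist p q - mdist q y) in
  [\/ quasicycle e p x q y, quasicycle e p q x y |
    [/\ u <= mdist x y + 10 * e, - u <= mdist x y + 10 * e &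
     mdist x y <= u + 10 * e \/ mdist x y <= - u + 10 * e]].
Proof.
move=> e0 pqx pqy pxy qxy pq qpx qpy.
have sym := (metric_sym q p, metric_sym x p, metric_sym y p, metric_sym x q,
  metric_sym y q, metric_sym y x).
move: (metric_triangle p x q) (metric_triangle p y q) (metric_triangle q p y)
  (metric_triangle x p y) (metric_triangle p y x) (metric_triangle p q x)
  (metric_triangle x q y) (metric_triangle q x y).
move: pq qpx qpy pqx pqy pxy qxy; rewrite /quasicycle /collinear /between !sym.
move: (mdist p q) (mdist p x) (mdist p y) (mdist q x) (mdist q y) (mdist x y).
move=> pq px py qx qy xy h qpx qpy.
case=> [?|?|?]; first by move=> *; exfalso; lra.
- case=> [?|?|?]; [|by move=> *; exfalso; lra|].
    case=> [?|?|?]; [|by move=> *; exfalso; lra|].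
      by move=> *; apply: Or33; split; [lra|lra|left; lra].
    case=> ? *; [|apply: Or32; split; lra|exfalso; lra].
    by apply: Or33; split; [lra|lra|left; lra].
  by move=> *; apply: Or33; split; [lra|lra|left; lra].
- case=> [?|?|?]; [|by move=> *; exfalso; lra|].
    by move=> *; apply: Or33; split; [lra|lra|left; lra].
  case=> [?|?|?].
  + case=> ? *; first (by apply: Or31; split; lra);
      (apply: Or33; split; [lra|lra|]).
      by left; lra.
    by right; lra.
  + by move=> *; apply: Or33; split; [lra|lra|right; lra].
  + by move=> *; apply: Or33; split; [lra|lra|left; lra].
Qed.

(** * Excluding quasicycles by a fifth point *)

Definition far e z p q x y :=
  [/\ 10 * e < mdist z p, 10 * e < mdist z q, 10 * e < mdist z x &
   10 * e < mdist z y].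

Definition collinear_pairs e p q x y z :=
  [/\ collinear e p q z, collinear e p x z & collinear e p y z] /\
  [/\ collinear e q x z, collinear e q y z & collinear e x y z].

Lemma quasicycle_short_side e p x q y z : 0 <= e -> quasicycle e p x q y ->
  collinear_pairs e p q x y z -> far e z p q x y ->
  [\/ mdist p x <= 3 * e, mdist q y <= 3 * e, mdist q x <= 3 * e |
      mdist p y <= 3 * e].
Proof.
move=> e0 C [[pqz pxz pyz] [qxz qyz xyz]] [zp zq zx zy].
have [?|px] := leP (mdist p x) (3 * e); first exact: Or41.
have [?|qy] := leP (mdist q y) (3 * e); first exact: Or42.
have xqz := collinear_swap qxz; have ypz := collinear_swap pyz.
have [||||qx|py] := quasicycle_degenerate e0 C pxz xqz qyz ypz pqz xyz
  _ _ _ _ px qy; try lra.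
- by rewrite metric_sym; exact: Or43.
- exact: Or44.
Qed.

(** The upper bound on |px - py| is the triangle inequality. For the lower bound, a quasicycle has a
    side of length at most [3 * e], so two of the points nearly coincide and the distance is again
    read off. *)
Lemma same_side_coord e p q x y z : 0 <= e ->
  collinear e p q x -> collinear e p q y -> collinear e p x y ->
  collinear e q x y -> collinear_pairs e p q x y z -> far e z p q x y ->
  10 * e < mdist p q -> mdist q x <= mdist p x -> mdist q y <= mdist p y ->
  `| `|mdist p x - mdist p y| - mdist x y| <= 10 * e.
Proof.
move=> e0 pqx pqy pxy qxy z5 zfar pq qpx qpy.
have sym := (metric_sym q p, metric_sym x p, metric_sym y p, metric_sym x q,
  metric_sym y q, metric_sym y x).
have := metric_triangle p x y; have := metric_triangle p y x.
rewrite !sym => tx ty.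
apply: norm_dist_le; [lra|lra|].
have [C|//] := same_side_quasicycle e0 pqx pqy pxy qxy pq qpx qpy.
have := quasicycle_short_side e0 C z5 zfar.
case: C; have := metric_triangle x p y; have := metric_triangle x q y;
  have := metric_triangle p x q; have := metric_triangle p y q.
rewrite /between !sym => ? ? ? ? ? ? ? ? [?|?|?|?].
- by right; lra.
- by right; lra.
- by left; lra.
- by left; lra.
Qed.

Lemma opposite_sides_coord e p q x y z : 0 <= e ->
  collinear e p q x -> collinear e p q y -> collinear e p x y ->
  collinear e q x y -> collinear_pairs e p q x y z -> far e z p q x y ->
  10 * e < mdist p q -> mdist q x <= mdist p x -> mdist p y <= mdist q y ->
  `| `|mdist p x - (mdist p q - mdist q y)| - mdist x y| <= 10 * e.
Proof.
move=> e0 pqx pqy pxy qxy z5 zfar pq qpx qpy.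
have sym := (metric_sym q p, metric_sym x p, metric_sym y p, metric_sym x q,
  metric_sym y q, metric_sym y x).
have [C|C|[? ? ?]] := opposite_sides_quasicycle e0 pqx pqy pxy qxy pq qpx qpy;
  last exact: norm_dist_le.
- have := quasicycle_short_side e0 C z5 zfar.
  case: C; have := metric_triangle x p y; have := metric_triangle x q y;
    have := metric_triangle p x q; have := metric_triangle p y q.
  have := mdist_ge0 q x; have := mdist_ge0 p y; rewrite /between !sym.
  by move=> ? ? ? ? ? ? ? ? ? ? [?|?|?|?]; apply: norm_dist_le; lra.
(* The cycle is now p, q, x, y, so [quasicycle_short_side] applies with q and x exchanged. *)
- have z5' : collinear_pairs e p x q y z.
    case: z5 => [[? ? ?] [? ? ?]]; split; split => //; exact: collinear_swap.
  have zfar' : far e z p x q y by case: zfar.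
  have := quasicycle_short_side e0 C z5' zfar'.
  case: C; have := metric_triangle x p y; have := metric_triangle p q x;
    have := metric_triangle q p y; have := metric_triangle q x y.
  have := metric_triangle p y x; have := metric_triangle x q y.
  have := mdist_ge0 q x; have := mdist_ge0 p y; rewrite /between !sym.
  by move=> ? ? ? ? ? ? ? ? ? ? ? ? [?|?|?|?]; apply: norm_dist_le; lra.
Qed.

Lemma line_coord_dist e p q x y z : 0 <= e ->
  collinear e p q x -> collinear e p q y -> collinear e p x y ->
  collinear e q x y -> collinear_pairs e p q x y z -> far e z p q x y ->
  10 * e < mdist p q ->
  `| `|line_coord p q x - line_coord p q y| - mdist x y| <= 10 * e.
Proof.
move=> e0 pqx pqy pxy qxy z5 zfar pq; rewrite /line_coord.
have [qpx|/ltW pqx'] := leP (mdist q x) (mdist p x);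
  have [qpy|/ltW pqy'] := leP (mdist q y) (mdist p y).
- exact: same_side_coord z5 zfar pq _ _.
- exact: opposite_sides_coord z5 zfar pq _ _.
- rewrite [X in `|X - _|]distrC (metric_sym x y).
  have z5' : collinear_pairs e p q y x z.
    case: z5 => [[? ? ?] [? ? ?]]; split; split => //; exact: collinear_swap.
  have zfar' : far e z p q y x by case: zfar.
  apply: opposite_sides_coord z5' zfar' pq _ _ => //.
    exact/collinear_rot/collinear_rot/collinear_swap/collinear_rot.
  exact/collinear_rot/collinear_rot/collinear_swap/collinear_rot.
(* Both points are nearer to p. The reflection of the line turns the coordinate into the distance to
   q, which gives the same side case with p and q exchanged. *)
- have -> (a b c : R) : a - b - (a - c) = - (b - c) by lra.
  rewrite normrN.
  have z5' : collinear_pairs e q p x y z.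
    case: z5 => [[? ? ?] [? ? ?]]; split; split => //; exact: collinear_swap.
  have zfar' : far e z q p x y by case: zfar.
  apply: same_side_coord z5' zfar' _ _ _ => //.
  - exact: collinear_swap.
  - exact: collinear_swap.
  - by rewrite metric_sym.
Qed.

End collinearity.

(** * The triangular excess *)

Section excess.
Context {R : realType} {X : metricType R}.
Implicit Types (x y z : X) (e : R).

Lemma ord3P (P : 'I_3 -> Prop) : P 0 -> P 1 -> P 2 -> forall i, P i.
Proof.
move=> P0 P1 P2 [[|[|[|//]]] i]; [move: P0|move: P1|move: P2];
  by congr P; exact/val_inj.
Qed.

(** Reversing an order keeps its value, so the six permutations give three values, one per middle
    point; the identity and two transpositions attain them. *)
Lemma excessE x y z : excess x y z =
  Order.min (Order.min (mdist x y + mdist y z - mdist x z)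
                       (mdist x z + mdist y z - mdist x y))
            (mdist x y + mdist x z - mdist y z).
Proof.
pose p := tnth [tuple x; y; z].
pose e (s : 'S_3) : R := mdist (p (s 0)) (p (s 1)) + mdist (p (s 1)) (p (s 2))
  - mdist (p (s 0)) (p (s 2)).
have -> : excess x y z = \big[Order.min/e 1%g]_(s : 'S_3) e s by [].
have p0 : p 0 = x by [].
have p1 : p 1 = y by [].
have p2 : p 2 = z by [].
set m := RHS.
have e1 : e 1%g = mdist x y + mdist y z - mdist x z by rewrite /e !perm1.
have e12 : e (tperm 1 2) = mdist x z + mdist y z - mdist x y.
  by rewrite /e tpermL tpermR tpermD// p0 p1 p2 (metric_sym z y).
have e01 : e (tperm 0 1) = mdist x y + mdist x z - mdist y z.
  by rewrite /e tpermL tpermR tpermD// p0 p1 p2 (metric_sym y x).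
have lem (s : 'S_3) : m <= e s.
  have inj := @perm_inj _ s.
  have s01 : s 0 != s 1 by rewrite (inj_eq inj).
  have s02 : s 0 != s 2 by rewrite (inj_eq inj).
  have s12 : s 1 != s 2 by rewrite (inj_eq inj).
  rewrite /e; move: (s 0) (s 1) (s 2) s01 s02 s12.
  rewrite /m; elim/ord3P; elim/ord3P; elim/ord3P => //= _ _ _;
    rewrite p0 p1 p2 ?(metric_sym y x) ?(metric_sym z y) ?(metric_sym z x);
    rewrite !ge_min; apply/orP; (try by right; lra);
    left; apply/orP; (try by right; lra); by left; lra.
apply/eqP; rewrite eq_le; apply/andP; split.
  rewrite /m !le_min -e1 -e12 -e01; apply/andP; split; [apply/andP; split|];
    exact: bigmin_le_cond.
by apply/bigmin_geP; split=> [|s _]; exact: lem.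
Qed.

Lemma excess_swap12 x y z : excess x y z = excess y x z.
Proof.
rewrite !excessE (metric_sym y x) [LHS]minC -[RHS]minA.
rewrite [in RHS](minC _ (_ + _ - mdist x z)).
by rewrite (addrC (mdist y z) (mdist x z)).
Qed.

Lemma excess_swap23 x y z : excess x y z = excess x z y.
Proof.
rewrite !excessE (metric_sym z y) [in RHS](minC (_ - mdist x y)).
by rewrite (addrC (mdist x z) (mdist x y)).
Qed.

Lemma excess_ge0 x y z : 0 <= excess x y z.
Proof.
move: (metric_triangle x y z) (metric_triangle y x z) (metric_triangle x z y).
rewrite excessE !le_min (metric_sym y x) (metric_sym z y) => *.
by apply/andP; split; [apply/andP; split|]; lra.
Qed.

Lemma excess_collinear e x y z : excess x y z <= e -> collinear e x y z.
Proof.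
rewrite excessE !ge_min /collinear /between (metric_sym y x) (metric_sym z y).
by move=> /orP[/orP[]|] ?; [apply: Or32|apply: Or33|apply: Or31]; lra.
Qed.

(** Each of the three values contains two distances from x, and each of these moves by at most d(x,
    x'). *)
Lemma excess_lip x x' y z : excess x y z <= excess x' y z + 2 * mdist x x'.
Proof.
move: (metric_triangle x x' y) (metric_triangle x x' z).
move: (metric_triangle x' x y) (metric_triangle x' x z).
rewrite (metric_sym x' x) => *.
rewrite -lerBlDr !excessE !le_min !lerBlDr !ge_min.
apply/andP; split; [apply/andP; split|]; apply/orP.
- by left; apply/orP; left; lra.
- by left; apply/orP; right; lra.
- by right; lra.
Qed.

End excess.

(** * Integrals of Lipschitz functions *)

Section lipschitz.
Context {R : realType} {X : pmetricType R}.
Variable mu : {measure set (borel X) -> \bar R}.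
Hypothesis bX : bounded_space X.
Hypothesis finmu : (mu [set: borel X] < +oo)%E.
Implicit Types (f g : X -> R) (k c : R).

(** A one-sided bound is enough, since x and y can be exchanged. The sign of [k] is free, which is
    why [|k|] appears below. *)
Definition lip f := exists k, forall x y, f x <= f y + k * mdist x y.

Lemma lip_continuous f : lip f -> continuous f.
Proof.
move=> [k fk] x; apply/cvgrPdist_lt => e e0.
have k0 : 0 < `|k| + 1 by rewrite ltr_pwDr.
have d0 : 0 < e / (`|k| + 1) by rewrite divr_gt0.
apply/nbhs_ballP; exists (e / (`|k| + 1)) => //= y.
rewrite ballEmdist /= ltr_pdivlMr// => xy.
have kd : k * mdist x y <= `|k| * mdist x y.
  by rewrite ler_wpM2r ?mdist_ge0 ?ler_norm.
have := fk x y; have := fk y x; rewrite (metric_sym y x) => fyx fxy.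
have := mdist_ge0 x y => d1.
by rewrite /= ltr_norml; nra.
Qed.

Lemma open_borel (U : set X) : open U -> measurable (U : set (borel X)).
Proof. exact: sub_sigma_algebra. Qed.

Lemma lip_mdist (a : X) : lip (mdist a).
Proof.
exists 1 => x y; rewrite mul1r (metric_sym x y); exact: metric_triangle.
Qed.

Lemma ball_borel (a : X) r : measurable (ball a r : set (borel X)).
Proof.
apply: open_borel; rewrite ballEmdist.
have /continuousP := lip_continuous (lip_mdist a).
by move=> /(_ _ (@open_lt R r)).
Qed.

Lemma lip_measurable (f : borel X -> R) : lip f -> measurable_fun [set: borel X] f.
Proof.
move=> /lip_continuous /continuousP cf.
apply: (measurability _ (RGenOpens.measurableE R)).
move=> _ [_ [a [b ->] <-]]; rewrite setTI; apply: open_borel.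
exact/cf/interval_open.
Qed.

Lemma lip_integrable (f : borel X -> R) : lip f -> mu.-integrable setT (EFin \o f).
Proof.
move=> fl; apply: measurable_bounded_integrable => //.
  exact: lip_measurable.
case: fl bX => k fk [M dM].
exists (`|f point| + `|k| * M); split; first exact: num_real.
move=> N MN y _ /=; apply: ltW; apply: le_lt_trans MN.
have kd (x z : X) : k * mdist x z <= `|k| * M.
  apply: (@le_trans _ _ (`|k| * mdist x z)).
    by rewrite ler_wpM2r ?mdist_ge0 ?ler_norm.
  by apply: ler_wpM2l => //; exact: dM.
have := fk y point; have := fk point y; have := kd y point; have := kd point y.
have := ler_norm (f point); have := ler_norm (- f point); rewrite normrN.
by move=> *; rewrite ler_norml; lra.
Qed.

Lemma lip_cst c : lip (fun=> c).
Proof. by exists 0 => x y; rewrite mul0r addr0. Qed.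

Lemma lipD f g : lip f -> lip g -> lip (fun x => f x + g x).
Proof.
move=> [k fk] [l gl]; exists (k + l) => x y.
by have := fk x y; have := gl x y; lra.
Qed.

Lemma lipZ c f : 0 <= c -> lip f -> lip (fun x => c * f x).
Proof.
move=> c0 [k fk]; exists (c * k) => x y.
by rewrite -mulrA -mulrDr ler_wpM2l ?fk.
Qed.

Local Notation I f := (\int[mu]_x (f : borel X -> R) x).
Local Notation m := (fine (mu [set: borel X])).

Lemma lip_RintegralD f g : lip f -> lip g ->
  I (fun x => f x + g x) = I f + I g.
Proof. by move=> fl gl; apply: RintegralD => //; exact: lip_integrable. Qed.

Lemma lip_RintegralZ c f : lip f -> I (fun x => c * f x) = c * I f.
Proof. by move=> fl; apply: RintegralZl => //; exact: lip_integrable. Qed.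

Lemma Rintegral_cstT c : I (fun=> c) = c * m.
Proof. exact: Rintegral_cst. Qed.

Lemma le_lip_Rintegral f g : lip f -> lip g -> (forall x, f x <= g x) ->
  I f <= I g.
Proof.
by move=> fl gl fg; apply: le_Rintegral => //; exact: lip_integrable.
Qed.

Lemma lip_EFin_Rintegral f : lip f ->
  (\int[mu]_x ((f : borel X -> R) x)%:E)%E = (I f)%:E.
Proof.
move=> fl; rewrite /Rintegral fineK//.
by apply: integrable_fin_num => //; exact: lip_integrable.
Qed.

(** Integration multiplies the Lipschitz constant in the parameter by the total mass; this keeps the
    partial integrals Lipschitz. *)
Lemma le_lip_Rintegral_param k (w : X -> X -> R) y y' : lip (w ^~ y) ->
  lip (w ^~ y') -> (forall x, w x y <= w x y' + k * mdist y y') ->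
  I (w ^~ y) <= I (w ^~ y') + k * m * mdist y y'.
Proof.
move=> w1 w2 w3.
have -> : k * m * mdist y y' = k * mdist y y' * m by lra.
rewrite -Rintegral_cstT -lip_RintegralD//; last exact: lip_cst.
by apply: le_lip_Rintegral => //; apply: lipD => //; exact: lip_cst.
Qed.

(** Carrying the value along with the Lipschitz property lets long sums be integrated term by
    term. *)
Definition lip_int f c := lip f /\ I f = c.

Lemma lip_int_cst c : lip_int (fun=> c) (c * m).
Proof. by split; [exact: lip_cst|exact: Rintegral_cstT]. Qed.

Lemma lip_intD f g c c' : lip_int f c -> lip_int g c' ->
  lip_int (fun x => f x + g x) (c + c').
Proof.
by move=> [fl <-] [gl <-]; split; [exact: lipD|exact: lip_RintegralD].
Qed.

Lemma lip_intZ a f c : 0 <= a -> lip_int f c ->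
  lip_int (fun x => a * f x) (a * c).
Proof.
by move=> a0 [fl <-]; split; [exact: lipZ|exact: lip_RintegralZ].
Qed.

(** Otherwise f > t = I f / c on A, and the integral of f - t over A is at most I f - t c = 0. A
    positive function with zero integral forces A to be null, against 0 < c. *)
Lemma exists_le_average (A : set (borel X)) (c : R) f : measurable A ->
  0 < c -> c <= fine (mu A) -> (forall x, 0 <= f x) -> lip f ->
  exists2 a, A a & f a * c <= I f.
Proof.
move=> mA c0 cA f0 fl; apply: contrapT => nA.
have mf : measurable_fun A (f : borel X -> R).
  by apply: measurable_funTS; exact: lip_measurable.
have intf : mu.-integrable A (EFin \o f).
  by apply: integrableS (lip_integrable fl).
pose t := I f / c.
have ft a : A a -> t < f a.
  move=> Aa; rewrite ltNge; apply/negP => fat; apply: nA; exists a => //.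
  by rewrite -ler_pdivlMr.
have t0 : 0 <= t.
  by apply: divr_ge0; [apply: Rintegral_ge0 => x _; exact: f0|exact: ltW].
have intt : mu.-integrable A (EFin \o (cst t : borel X -> R)).
  by apply: integrableS (lip_integrable (lip_cst t)).
have : \int[mu]_(x in A) (f x - t) = 0.
  apply/eqP; rewrite eq_le; apply/andP; split; last first.
    by apply: Rintegral_ge0 => x /ft; rewrite subr_ge0 => /ltW.
  rewrite RintegralB// Rintegral_cst// subr_le0.
  apply: (@le_trans _ _ (I f)).
    rewrite fine_le//.
    - exact: integrable_fin_num.
    - by apply: integrable_fin_num => //; exact: lip_integrable.
    - apply: ge0_subset_integral => //.
      - by apply/measurable_EFinP; exact: lip_measurable.
      - by move=> x _; rewrite lee_fin.
  by rewrite -(@divfK _ c _ (I f)) ?gt_eqF// -/t ler_wpM2l.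
move=> int0.
have : ae_eq mu A (EFin \o (fun x => f x - t)) (cst 0%E).
  apply/ae_eq_integral_abs => //.
    by apply/measurable_EFinP; apply: measurable_funB.
  under eq_integral => x /[!inE] /ft ftx.
    rewrite gee0_abs; last by rewrite lee_fin subr_ge0 ltW.
    over.
  rewrite -[LHS]fineK; first by congr EFin; exact: int0.
  apply: integrable_fin_num => //.
  by apply: integrableS (lip_integrable (lipD fl (lip_cst (- t)))).
move=> [N [mN N0 AN]].
have : mu A = 0%E.
  apply: (subset_measure0 mA mN _ N0); apply: subset_trans AN => x Ax /=.
  by move=> /(_ Ax)[] /eqP; rewrite subr_eq0 gt_eqF// ft.
by move=> A0; move: cA; rewrite A0 /= leNgt c0.
Qed.

End lipschitz.

(* To compare iterated integrals, [ge0_le_integral] would need the inner ones to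
   be measurable in the outer variable. *)
Lemma ge0_le_integralT d (T : measurableType d) (R : realType)
    (mu : {measure set T -> \bar R}) (f g : T -> \bar R) :
  (forall x, 0 <= f x)%E -> (forall x, f x <= g x)%E ->
  (\int[mu]_x f x <= \int[mu]_x g x)%E.
Proof.
move=> f0 fg; have g0 x : (0 <= g x)%E by exact: le_trans (fg x).
rewrite !ge0_integralTE//; apply: ge_ereal_sup => _ [h hf <-].
by apply: ereal_sup_ubound; exists h => // x; exact: le_trans (fg x).
Qed.

(** * Averaging over triples *)

Section triple_average.
Context {R : realType} {X : pmetricType R}.
Variable mu : {measure set (borel X) -> \bar R}.
Hypothesis bX : bounded_space X.
Hypothesis finmu : (mu [set: borel X] < +oo)%E.
Variables (k delta : R) (w : X -> X -> X -> R).
Local Notation I f := (\int[mu]_x (f : borel X -> R) x).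
Local Notation m := (fine (mu [set: borel X])).
Hypothesis m0 : 0 < m.
Hypothesis small_ball : forall a : X, fine (mu (ball a delta)) <= m / 8.
Hypothesis w0 : forall x y z, 0 <= w x y z.
Hypothesis w12 : forall x y z, w x y z = w y x z.
Hypothesis w23 : forall x y z, w x y z = w x z y.
Hypothesis wlip : forall x x' y z, w x y z <= w x' y z + k * mdist x x'.
Implicit Types (x y z p q : X).

(** These integrals are not divided by the total mass. By the symmetry of [w] it does not matter
    which variables are integrated. *)
Definition avg1 y z := I (fun x => w x y z).
Definition avg2 z := I (fun y => avg1 y z).
Definition avg3 := I avg2.

Lemma lipw1 y z : lip (fun x => w x y z).
Proof. by exists k => x x'; exact: wlip. Qed.

Lemma lipw2 x z : lip (fun y => w x y z).
Proof. by exists k => y y' /=; rewrite (w12 x y) (w12 x y'); exact: wlip. Qed.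

Lemma lipw3 x y : lip (fun z => w x y z).
Proof. by exists k => z z' /=; rewrite !(w23 x y) !(w12 x _ y); exact: wlip. Qed.

Lemma avg1_sym y z : avg1 y z = avg1 z y.
Proof. by rewrite /avg1; under eq_Rintegral do rewrite w23. Qed.

Lemma avg1_le y y' z : avg1 y z <= avg1 y' z + k * m * mdist y y'.
Proof.
apply: (@le_lip_Rintegral_param _ _ mu bX finmu k (fun x y => w x y z)).
- exact: lipw1.
- exact: lipw1.
- by move=> x; rewrite (w12 x y) (w12 x y'); exact: wlip.
Qed.

Lemma lip_avg1l z : lip (fun y => avg1 y z).
Proof. by exists (k * m) => y y'; exact: avg1_le. Qed.

Lemma lip_avg1r y : lip (fun z => avg1 y z).
Proof.
by exists (k * m) => z z'; rewrite avg1_sym (avg1_sym y); exact: avg1_le.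
Qed.

Lemma lip_avg2 : lip avg2.
Proof.
exists (k * m * m) => z z'.
apply: (@le_lip_Rintegral_param _ _ mu bX finmu (k * m) (fun y z => avg1 y z)).
- exact: lip_avg1l.
- exact: lip_avg1l.
- by move=> y; rewrite avg1_sym (avg1_sym y); exact: avg1_le.
Qed.

Lemma avg1_ge0 y z : 0 <= avg1 y z.
Proof. by apply: Rintegral_ge0 => x _; exact: w0. Qed.

Lemma avg2_ge0 z : 0 <= avg2 z.
Proof. by apply: Rintegral_ge0 => y _; exact: avg1_ge0. Qed.

Lemma lip_int_w3 x y : lip_int mu (fun z => w x y z) (avg1 x y).
Proof.
split; first exact: lipw3.
by apply: eq_Rintegral => z _; rewrite w23 w12.
Qed.

Lemma lip_int_w2 x z : lip_int mu (fun y => w x y z) (avg1 x z).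
Proof.
by split; [exact: lipw2|apply: eq_Rintegral => y _; rewrite w12].
Qed.

Lemma lip_int_avg1l z : lip_int mu (fun y => avg1 y z) (avg2 z).
Proof. by split; first exact: lip_avg1l. Qed.

Lemma lip_int_avg1r y : lip_int mu (fun z => avg1 y z) (avg2 y).
Proof.
split; first exact: lip_avg1r.
by apply: eq_Rintegral => z _; rewrite avg1_sym.
Qed.

Lemma lip_int_avg2 : lip_int mu avg2 avg3.
Proof. by split; first exact: lip_avg2. Qed.

Lemma avg3_EFin : (\int[mu]_(z in [set: borel X])
  \int[mu]_(y in [set: borel X]) \int[mu]_(x in [set: borel X])
    (w x y z)%:E = avg3%:E)%E.
Proof.
rewrite -lip_EFin_Rintegral//; last exact: lip_avg2.
apply: eq_integral => z _; rewrite -lip_EFin_Rintegral//; last exact: lip_avg1l.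
by apply: eq_integral => y _; rewrite -lip_EFin_Rintegral//; exact: lipw1.
Qed.

(* Otherwise conversion tests between distinct averages compare integrals. *)
#[local] Opaque avg1 avg2 avg3.

Definition away p q x y : set X :=
  ~` (ball p delta `|` ball q delta `|` (ball x delta `|` ball y delta)).

Lemma away_measurable p q x y : measurable (away p q x y : set (borel X)).
Proof.
by apply: measurableC; do 2?apply: measurableU; exact: ball_borel.
Qed.

(** Four balls of mass at most m / 8 each take away at most half of the space. *)
Lemma away_measure p q x y : m / 2 <= fine (mu (away p q x y)).
Proof.
have mb a : measurable (ball a delta : set (borel X)).
  by exact: ball_borel.
have fin (A : set (borel X)) : measurable A -> mu A \is a fin_num.
  move=> mA; rewrite ge0_fin_numE//; apply: le_lt_trans finmu.
  by apply: le_measure; rewrite ?inE.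
have U2 (A B : set (borel X)) : measurable A -> measurable B ->
    fine (mu (A `|` B)) <= fine (mu A) + fine (mu B).
  move=> mA mB; rewrite -lee_fin EFinD !fineK ?fin//; last exact: measurableU.
  exact: measureU2.
have mpq : measurable (ball p delta `|` ball q delta : set (borel X)).
  exact: measurableU.
have mxy : measurable (ball x delta `|` ball y delta : set (borel X)).
  exact: measurableU.
have := U2 _ _ (measurableU _ _ mpq mxy) (away_measurable p q x y).
rewrite /away setUv.
have := U2 _ _ mpq mxy; have := U2 _ _ (mb p) (mb q).
have := U2 _ _ (mb x) (mb y).
move: (small_ball p) (small_ball q) (small_ball x) (small_ball y).
by move=> *; lra.
Qed.

Lemma awayP p q x y z : away p q x y z ->
  [/\ delta <= mdist z p, delta <= mdist z q, delta <= mdist z x &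
      delta <= mdist z y].
Proof.
rewrite /away !setCU !ballEmdist /= => -[[]] /negP; rewrite -leNgt => zp.
move=> /negP; rewrite -leNgt => zq [] /negP; rewrite -leNgt => zx.
move=> /negP; rewrite -leNgt => zy.
by split; rewrite metric_sym.
Qed.

Let intc c := lip_int_cst mu c.
Let intD := lip_intD bX finmu.
Let intZ f c := @lip_intZ _ _ mu bX finmu m f c (ltW m0).

(** First p is chosen over all of X, then q outside the ball about p. Averaging a single sum in q
    makes both of its terms small at the same q; the weight [m] gives them the same scaling. *)
Lemma exists_base_pair : exists p q, [/\ delta <= mdist p q,
  avg2 p * (m / 2) <= avg3 &
  (avg2 q + m * avg1 p q) * (m / 2) <= avg3 + m * avg2 p].
Proof.
have mh : 0 < m / 2 by rewrite divr_gt0.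
have mm : m / 2 <= m by lra.
have [p _ pT] := exists_le_average bX finmu measurableT mh mm avg2_ge0 lip_avg2.
have [lq Iq] : lip_int mu (fun q => avg2 q + m * avg1 p q) (avg3 + m * avg2 p).
  exact: intD lip_int_avg2 (intZ (lip_int_avg1r p)).
have [|q /awayP[pq _ _ _] qT] := exists_le_average bX finmu
  (away_measurable p p p p) mh (away_measure p p p p) _ lq.
  by move=> q; rewrite addr_ge0 ?avg2_ge0// mulr_ge0 ?avg1_ge0// ltW.
exists p, q; split => //; first by rewrite metric_sym.
by rewrite -Iq.
Qed.

(** The digit in [total5], [total4], [total3] counts the points left free as z and then x are
    integrated out. *)
Definition total5 p q x y z :=
  w p q x + w p q y + w p x y + w q x y +
  (w p q z + w p x z + w p y z + w q x z + w q y z + w x y z).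

Definition total4 p q x y :=
  m * (w p q x + w p q y + w p x y + w q x y) +
  (avg1 p q + avg1 p x + avg1 p y + avg1 q x + avg1 q y + avg1 x y).

Lemma lip_int_total5 p q x y : lip_int mu (total5 p q x y) (total4 p q x y).
Proof.
have [? I5] : lip_int mu (total5 p q x y) _ :=
  intD (intc _) (intD (intD (intD (intD (intD (lip_int_w3 p q)
    (lip_int_w3 p x)) (lip_int_w3 p y)) (lip_int_w3 q x)) (lip_int_w3 q y))
    (lip_int_w3 x y)).
by split => //; rewrite I5 mulrC.
Qed.

Definition total3 p q y :=
  m * (avg1 p q + m * w p q y + avg1 p y + avg1 q y) +
  (m * avg1 p q + avg2 p + m * avg1 p y + avg2 q + m * avg1 q y + avg2 y).

Lemma lip_int_total4 p q y :
  lip_int mu (fun x => total4 p q x y) (total3 p q y).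
Proof.
have [? I4] : lip_int mu (fun x => total4 p q x y) _ :=
  intD (intZ (intD (intD (intD (lip_int_w3 p q) (intc _)) (lip_int_w2 p y))
      (lip_int_w2 q y)))
    (intD (intD (intD (intD (intD (intc _) (lip_int_avg1r p)) (intc _))
      (lip_int_avg1r q)) (intc _)) (lip_int_avg1l y)).
by split => //; rewrite I4 /total3 ![_ * m]mulrC.
Qed.

(** Of the ten triples three contain p and q, three only p, three only q, and one neither. *)
Lemma lip_int_total3 p q : lip_int mu (total3 p q)
  (3 * m * (m * avg1 p q + avg2 p + avg2 q) + avg3).
Proof.
have [? I3] : lip_int mu (total3 p q) _ :=
  intD (intZ (intD (intD (intD (intc _) (intZ (lip_int_w3 p q)))
      (lip_int_avg1r p)) (lip_int_avg1r q)))
    (intD (intD (intD (intD (intD (intc _) (intc _))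
      (intZ (lip_int_avg1r p))) (intc _)) (intZ (lip_int_avg1r q)))
      lip_int_avg2).
split => //; rewrite I3.
by move: (avg1 p q) (avg2 p) (avg2 q) avg3 m => *; lra.
Qed.

Lemma total5_ge0 p q x y z : 0 <= total5 p q x y z.
Proof. by rewrite !addr_ge0. Qed.

(** For fixed x and y, averaging [total5] over the set [away p q x y], of mass at least m / 2,
    bounds [err] by 2 K / m times [total4]. This no longer involves z, so the choice of z need not
    be measurable in x and y. *)
Lemma le_integral_avg3 (K : R) (err : X -> X -> R) p q : 0 <= K ->
  (forall x y, 0 <= err x y) ->
  (forall x y z, away p q x y z -> err x y <= K * total5 p q x y z) ->
  avg2 p * (m / 2) <= avg3 ->
  (avg2 q + m * avg1 p q) * (m / 2) <= avg3 + m * avg2 p ->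
  (\int[mu]_(y in [set: borel X]) \int[mu]_(x in [set: borel X])
     (err x y)%:E <= (50 * K / m * avg3)%:E)%E.
Proof.
move=> K0 err0 errK pT qT.
have mh : 0 < m / 2 by rewrite divr_gt0.
have K2 : 0 <= 2 * K / m by rewrite divr_ge0 ?mulr_ge0// ltW.
have err4 x y : err x y <= 2 * K / m * total4 p q x y.
  have [lK IK] := lip_intZ bX finmu K0 (lip_int_total5 p q x y).
  have [|z az] := exists_le_average bX finmu (away_measurable p q x y) mh
    (away_measure p q x y) _ lK.
    by move=> z; rewrite mulr_ge0 ?total5_ge0.
  rewrite IK => h; have {}h : err x y * (m / 2) <= K * total4 p q x y.
    by apply: le_trans h; rewrite ler_pM2r ?errK.
  rewrite -ler_pdivlMr// in h; apply: le_trans h _.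
  rewrite invf_div; move: (total4 p q x y) m => t n.
  by rewrite (_ : K * t * (2 / n) = 2 * K / n * t)//; ring.
apply: (@le_trans _ _ (\int[mu]_(y in [set: borel X])
    (2 * K / m * total3 p q y)%:E)%E).
  apply: ge0_le_integralT => y.
    by apply: integral_ge0 => x _; rewrite lee_fin.
  have [l4 <-] := lip_intZ bX finmu K2 (lip_int_total4 p q y).
  rewrite -lip_EFin_Rintegral//.
  by apply: ge0_le_integralT => x; rewrite lee_fin.
have [l3 I3] := lip_intZ bX finmu K2 (lip_int_total3 p q).
rewrite lip_EFin_Rintegral// I3 lee_fin.
(* 25 = 3 (2 + 6) + 1: avg2 p <= 2 avg3 / m, hence avg2 q + m avg1 p q <= (2 / m) (avg3 + 2 avg3) =
   6 avg3 / m. *)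
have -> : 50 * K / m * avg3 = 2 * K / m * (25 * avg3).
  by move: m avg3 => *; lra.
apply: ler_wpM2l => //; move: pT qT (avg2_ge0 p) (avg2_ge0 q).
by move: (avg1 p q) (avg2 p) (avg2 q) avg3 m => *; lra.
Qed.

End triple_average.

(** * Regular spaces *)

Section regular.
Context {R : realType} {X : pmetricType R}.
Variable C : R.
Hypothesis bX : bounded_space X.
Hypothesis regX : regular1 X C.
Local Notation mu := (hausdorff1_measure X).
Local Notation D := (fine (diam [set: X])).
Local Notation m := (fine (mu [set: borel X])).

Lemma bounded_diam_fin : diam [set: X] \is a fin_num.
Proof.
rewrite ge0_fin_numE ?diam_ge0//; have [M dM] := bX.
apply: (@le_lt_trans _ _ M%:E); last exact: ltry.
apply: ge_ereal_sup => _ [->|[[x y] _ <-]]; rewrite lee_fin ?dM//.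
exact: le_trans (mdist_ge0 point point) (dM _ _).
Qed.

Lemma bounded_diam_EFin : diam [set: X] = D%:E.
Proof. by rewrite fineK ?bounded_diam_fin. Qed.

Lemma mdist_le_diam (x y : X) : mdist x y <= D.
Proof. by rewrite -lee_fin -bounded_diam_EFin; exact: le_mdist_diam. Qed.

Lemma regular_const_ge1 : 1 <= C. Proof. by case: regX. Qed.

Lemma regular_diam_gt0 : 0 < D.
Proof. by case: regX => _; rewrite bounded_diam_EFin lte_fin. Qed.

Lemma regular_ball (x : X) r : 0 < r -> r < 2 * D ->
  ((C^-1 * r)%:E <= mu (ball x r) <= (C * r)%:E)%E.
Proof.
move=> r0 rD; case: regX => _ _; apply => //.
by rewrite bounded_diam_EFin -EFinM lte_fin.
Qed.

Lemma regular_measure_lty : (mu [set: borel X] < +oo)%E.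
Proof.
have D0 := regular_diam_gt0.
(* Any radius strictly between D and 2 D works: the open ball is the whole space and regularity
   still applies. *)
have -> : [set: borel X] = ball (point : X) (3 / 2 * D).
  apply/seteqP; split => // x _; rewrite ballEmdist /=.
  by have := mdist_le_diam point x; lra.
have /andP[_ h] : ((C^-1 * (3 / 2 * D))%:E <= mu (ball (point : X) (3 / 2 * D))
  <= (C * (3 / 2 * D))%:E)%E by apply: regular_ball; lra.
exact: le_lt_trans h (ltry _).
Qed.

Lemma regular_measure_fin (A : set (borel X)) : measurable A ->
  mu A \is a fin_num.
Proof.
move=> mA; rewrite ge0_fin_numE//; apply: le_lt_trans regular_measure_lty.
by apply: le_measure; rewrite ?inE.
Qed.

Lemma regular_measure_ge : D <= C * m.
Proof.
have D0 := regular_diam_gt0; have C1 := regular_const_ge1.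
have /andP[h _] : ((C^-1 * D)%:E <= mu (ball (point : X) D) <= (C * D)%:E)%E.
  by apply: regular_ball; lra.
rewrite -ler_pdivrMl; last lra.
rewrite -lee_fin fineK ?regular_measure_fin//; apply: le_trans h _.
by apply: le_measure; rewrite ?inE//; exact: ball_borel.
Qed.

(** The radius makes the upper regularity bound equal to D / (8 C), and D <= C m by the lower
    one. *)
Lemma regular_small_ball (a : X) :
  fine (mu (ball a (D / (8 * C ^+ 2)))) <= m / 8.
Proof.
have D0 := regular_diam_gt0; have C1 := regular_const_ge1.
have C2 : 1 <= C ^+ 2 by rewrite exprn_ege1.
have d0 : 0 < D / (8 * C ^+ 2) by rewrite divr_gt0//; lra.
have /andP[_ h] : ((C^-1 * (D / (8 * C ^+ 2)))%:E <=
    mu (ball a (D / (8 * C ^+ 2))) <= (C * (D / (8 * C ^+ 2)))%:E)%E.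
  apply: regular_ball => //; rewrite ltr_pdivrMr; last lra.
  by nra.
rewrite -lee_fin fineK ?regular_measure_fin//; last exact: ball_borel.
apply: le_trans h _; rewrite lee_fin.
have -> : C * (D / (8 * C ^+ 2)) = D / (8 * C) by field; lra.
rewrite ler_pdivrMr; last lra.
by have := regular_measure_ge; lra.
Qed.

End regular.

(** * The defect of the line coordinate bounded by excesses *)

Section line_coord.
Context {R : realType} {X : pmetricType R}.
Implicit Types p q x y : X.

Lemma line_coord_measurable p q :
  measurable_fun [set: borel X] (line_coord p q : borel X -> R).
Proof.
have mp (a : X) : measurable_fun [set: borel X] (mdist a : borel X -> R).
  by apply: lip_measurable; exact: lip_mdist.
apply: measurable_fun_ifT => //=.
  exact: measurable_fun_ler.
exact: measurable_funB.
Qed.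

(** A crude bound for the case of large excess: coordinates lie in [-D, D]. *)
Lemma line_coord_dist_le (D : R) p q x y : (forall a b : X, mdist a b <= D) ->
  `| `|line_coord p q x - line_coord p q y| - mdist x y| <= 2 * D.
Proof.
move=> dD.
have lcP a : - D <= line_coord p q a <= D.
  rewrite /line_coord; move: (mdist_ge0 p a) (mdist_ge0 q a) (dD p a) (dD q a).
  by move: (dD p q) (mdist_ge0 p q); case: ifP => _ *; apply/andP; split; lra.
have /andP[? ?] := lcP x; have /andP[? ?] := lcP y.
have ? := mdist_ge0 x y; have ? := dD x y.
rewrite ler_norml; have := normr_ge0 (line_coord p q x - line_coord p q y).
have : `|line_coord p q x - line_coord p q y| <= 2 * D.
  by rewrite ler_norml; lra.
by move: (`|_ - line_coord p q y|) => *; lra.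
Qed.

Lemma line_coord_excess (D delta : R) p q x y z :
  let w a b c := excess a b c / D in
  0 < delta -> delta <= D -> (forall a b : X, mdist a b <= D) ->
  delta <= mdist p q ->
  [/\ delta <= mdist z p, delta <= mdist z q, delta <= mdist z x &
      delta <= mdist z y] ->
  `| `|line_coord p q x - line_coord p q y| - mdist x y| / D <=
  20 * D / delta * total5 w p q x y z.
Proof.
move=> w d0 dD mD pq [zp zq zx zy].
have D0 : 0 < D by exact: lt_le_trans dD.
have w0 a b c : 0 <= w a b c by rewrite divr_ge0 ?excess_ge0// ltW.
set E := total5 w p q x y z.
have E0 : 0 <= E by exact: total5_ge0.
have le_e a b c : w a b c <= E -> collinear (D * E) a b c.
  by move=> h; apply: excess_collinear; rewrite mulrC -ler_pdivrMr.
have [[[h1 h2] [h3 h4]] [[h5 h6] [h7 h8]] [h9 h10]] :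
    [/\ (w p q x <= E /\ w p q y <= E) /\ (w p x y <= E /\ w q x y <= E),
      (w p q z <= E /\ w p x z <= E) /\ (w p y z <= E /\ w q x z <= E) &
      w q y z <= E /\ w x y z <= E].
  rewrite /E /total5.
  move: (w0 p q x) (w0 p q y) (w0 p x y) (w0 q x y) (w0 p q z) (w0 p x z)
    (w0 p y z) (w0 q x z) (w0 q y z) (w0 x y z).
  move: (w p q x) (w p q y) (w p x y) (w q x y) (w p q z) (w p x z) (w p y z)
    (w q x z) (w q y z) (w x y z) => *.
  by split; split; try split; lra.
rewrite ler_pdivrMr//.
have -> : 20 * D / delta * E * D = 2 * D * (10 * (D * E) / delta).
  by move: E {E0 le_e h1 h2 h3 h4 h5 h6 h7 h8 h9 h10} => E; ring.
have DE0 : 0 <= D * E by rewrite mulr_ge0// ltW.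
(* With e = D E, which dominates all ten excesses, either [line_coord_dist] applies, or 10 D E /
   delta >= 1 and the crude bound 2 D suffices. *)
have [small|big] := ltP (10 * (D * E)) delta.
  apply: (@le_trans _ _ (10 * (D * E))).
    apply: (@line_coord_dist _ _ (D * E) p q x y z) => //; try exact: le_e.
    - by split; split; exact: le_e.
    - by split; exact: lt_le_trans small _.
    - exact: lt_le_trans small _.
  rewrite [2 * D * _]mulrA [2 * D * _ / _]mulrAC.
  rewrite ler_peMl ?mulr_ge0// ?(ltW D0)// ler_pdivlMr// mul1r.
  by apply: le_trans dD _; rewrite ler_peMl ?ler1n// ltW.
apply: le_trans (line_coord_dist_le p q x y mD) _.
by rewrite ler_peMr ?mulr_ge0 ?(ltW D0)// ler_pdivlMr// mul1r.
Qed.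

End line_coord.

(** * The inequality on a regular space, with its constant *)

Unset Implicit Arguments.
Local Open Scope ereal_scope.

Theorem theorem4p19 (R : realType) (CX : R) :
  exists C : R, forall X : pmetricType R,
    bounded_space X -> regular1 X CX ->
    let mu : {measure set (borel X) -> \bar R} := hausdorff1_measure X in
    exists f : borel X -> R, measurable_fun [set: borel X] f /\
      (mu [set: borel X] ^+ 2)^-1 *
        \int[mu]_y \int[mu]_x
          (`| `|f x - f y| - mdist (x : X) (y : X)|%:E / diam [set: X])
      <= C%:E / mu [set: borel X] ^+ 3 *
        \int[mu]_z \int[mu]_y \int[mu]_x
          ((excess (x : X) (y : X) (z : X))%:E / diam [set: X]).
Proof.
(* 8000 = 50 * 160: the factor 50 comes from [le_integral_avg3], and 160 CX^2 = 20 D / delta for the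
   ball radius delta = D / (8 CX^2). *)
exists (8000 * CX ^+ 2)%R => X bX rX mu.
have finmu := regular_measure_lty bX rX.
have D0 := regular_diam_gt0 bX rX.
have C1 := regular_const_ge1 rX.
have ball8 := regular_small_ball bX rX.
have dD := mdist_le_diam bX.
have mD := regular_measure_ge bX rX.
rewrite (bounded_diam_EFin bX).
have -> : mu [set: borel X] = (fine (mu [set: borel X]))%:E.
  by rewrite fineK// (regular_measure_fin bX rX).
rewrite -/mu in finmu ball8 mD.
move: (fine (diam _)) D0 ball8 dD mD => D D0 ball8 dD mD.
have m0 : (0 < fine (mu [set: borel X]))%R.
  have : (0 < CX * fine (mu [set: borel X]))%R by exact: lt_le_trans mD.
  by rewrite pmulr_rgt0//; lra.
pose w (x y z : X) := (excess x y z / D)%R.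
have w0 x y z : (0 <= w x y z)%R by rewrite divr_ge0 ?excess_ge0// ltW.
have w12 x y z : w x y z = w y x z by rewrite /w excess_swap12.
have w23 x y z : w x y z = w x z y by rewrite /w excess_swap23.
have wlip x x' y z : (w x y z <= w x' y z + 2 / D * mdist x x')%R.
  by rewrite /w mulrAC -mulrDl ler_pM2r ?invr_gt0// excess_lip.
have [p [q [pq pT qT]]] :=
  exists_base_pair bX finmu m0 ball8 w0 w12 w23 wlip.
exists (line_coord p q); split; first exact: line_coord_measurable.
have EFin_div (r : R) : r%:E / D%:E = (r / D)%:E by rewrite inver gt_eqF.
under eq_integral do under eq_integral do rewrite EFin_div.
under [in leRHS]eq_integral do under eq_integral do under eq_integral do
  rewrite EFin_div -/(w _ _ _).
rewrite (avg3_EFin bX finmu w12 w23 wlip).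
pose err (x y : X) :=
  (`| `|line_coord p q x - line_coord p q y| - mdist x y| / D)%R.
have err0 x y : (0 <= err x y)%R by rewrite divr_ge0// ltW.
have C20 : (0 < 8 * CX ^+ 2)%R.
  by rewrite mulr_gt0// exprn_gt0// (lt_le_trans _ C1).
have K0 : (0 <= 160 * CX ^+ 2)%R by rewrite mulr_ge0// sqr_ge0.
have errK x y z : away (D / (8 * CX ^+ 2)) p q x y z ->
    (err x y <= 160 * CX ^+ 2 * total5 w p q x y z)%R.
  move=> /awayP far.
  have dD' : (D / (8 * CX ^+ 2) <= D)%R.
    by rewrite ler_pdivrMr// ler_peMr ?(ltW D0)// mulr_ege1 ?exprn_ege1 ?ler1n.
  have := line_coord_excess (divr_gt0 D0 C20) dD' dD pq far.
  rewrite (_ : 20 * D / (D / (8 * CX ^+ 2)) = 160 * CX ^+ 2)%R//.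
  by field; rewrite !gt_eqF// (lt_le_trans _ C1).
have := le_integral_avg3 bX finmu m0 ball8 w0 w12 w23 wlip K0 err0 errK pT qT.
set J := (\int[mu]_y _); set T := avg3 mu w.
move: m0; set m := fine (mu [set: borel X]) => m0 JT.
rewrite -!EFin_expe !inver !gt_eqF ?exprn_gt0// -!EFinM.
apply: (@le_trans _ _ ((m ^+ 2)^-1%:E * (50 * (160 * CX ^+ 2) / m * T)%:E)).
  by apply: lee_wpmul2l => //; rewrite lee_fin invr_ge0 exprn_ge0// ltW.
rewrite -EFinM lee_fin le_eqVlt; apply/orP; left; apply/eqP.
by field; rewrite gt_eqF.
Qed.
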